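(* The special Heisenberg Lie superalgebra $H(m,n)$ is $2$-capable if and only if $m=1$ and $n=0$.
   Context: Lie superalgebras are over a fixed algebraically closed ground field. A Heisenberg Lie superalgebra is a finite-dimensional Lie superalgebra $L$ with $Z(L)=[L,L]$ and $\dim Z(L)=1$. It is called special if its centre is even; $H(m,n)$ (with $m+n\ge 1$) denotes the special Heisenberg Lie superalgebra of dimension $(2m+1\mid n)$ (even dimension $2m+1$, odd dimension $n$). Explicitly it has even basis $x_1,\dots,x_{2m},z$ and odd basis $y_1,\dots,y_n$ with nonzero brackets (up to supersymmetry) $[x_i,x_{m+i}]=z$ for $1\le i\le m$ and $[y_j,y_j]=z$ for $1\le j\le n$. For a Lie superalgebra $H$, $Z(H)$ is the centre and $Z_2(H)=\{x\in H\mid [x,H]\subseteq Z(H)\}$. A Lie superalgebra $L$ is $2$-capable if there exists a Lie superalgebra $H$ with $L\cong H/Z_2(H)$. *)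

(* Defs.v *)
From HB Require Import structures.
From mathcomp Require Import all_boot all_algebra generic_quotient boolp ring.

Set Implicit Arguments.
Unset Strict Implicit.
Unset Printing Implicit Defensive.

Import GRing.Theory.
Local Open Scope ring_scope.
Local Open Scope quotient_scope.

(* A parity is a bool, [false] being even and [true] odd, so that addition of
   parities is [addb] and the sign (-1)^{|x||y|} is [(-1) ^+ (a && b)].
   [br_even_alt] and [br_odd_cube] follow from [br_skew] and [br_jacobi] when
   2 and 3 are invertible in F; they are the usual additional axioms in
   characteristics 2 and 3. *)
Record lieSuperalgebra (F : fieldType) := LieSuperalgebra {
  carrier :> lmodType F;
  homog : bool -> {pred carrier};
  br : {bilinear carrier -> carrier -> carrier};
  homog_submod : forall a, submod_closed (homog a);
  homog_span : forall x : carrier,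
    exists x0 x1, [/\ x0 \in homog false, x1 \in homog true & x = x0 + x1];
  homog_disjoint : forall x : carrier,
    x \in homog false -> x \in homog true -> x = 0;
  br_homog : forall a b x y, x \in homog a -> y \in homog b ->
    br x y \in homog (a (+) b);
  br_skew : forall a b x y, x \in homog a -> y \in homog b ->
    br x y = - ((-1) ^+ (a && b) *: br y x);
  br_jacobi : forall a b c x y z,
    x \in homog a -> y \in homog b -> z \in homog c ->
    br x (br y z) = br (br x y) z + (-1) ^+ (a && b) *: br y (br x z);
  br_even_alt : forall x, x \in homog false -> br x x = 0;
  br_odd_cube : forall x, x \in homog true -> br x (br x x) = 0
}.

Arguments homog {F} l a _.
Arguments br {F l}.

HB.instance Definition _ (F : fieldType) (L : lieSuperalgebra F) (a : bool) :=
  GRing.isSubmodClosed.Build F L (homog L a) (homog_submod L a).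

Definition lsa_iso (F : fieldType) (L M : lieSuperalgebra F) : Prop :=
  exists f : {linear L -> M},
    [/\ bijective f,
        forall a x, x \in homog L a -> f x \in homog M a &
        forall x y, f (br x y) = br (f x) (f y)].

Record gradedIdeal (F : fieldType) (L : lieSuperalgebra F) := GradedIdeal {
  ideal_pred : {pred L};
  ideal_submod : submod_closed ideal_pred;
  ideal_brl : forall x y, x \in ideal_pred -> br x y \in ideal_pred;
  ideal_brr : forall x y, y \in ideal_pred -> br x y \in ideal_pred;
  ideal_graded : forall x0 x1, x0 \in homog L false -> x1 \in homog L true ->
    x0 + x1 \in ideal_pred -> x0 \in ideal_pred /\ x1 \in ideal_pred
}.

Arguments ideal_pred {F L} g _.

HB.instance Definition _ (F : fieldType) (L : lieSuperalgebra F)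
    (I : gradedIdeal L) :=
  GRing.isSubmodClosed.Build F L (ideal_pred I) (ideal_submod I).

Section Quotient.
Variables (F : fieldType) (L : lieSuperalgebra F) (I : gradedIdeal L).

Definition quo : Type := Quotient.quot (ideal_pred I).
HB.instance Definition _ := GRing.Zmodule.on quo.

Definition quo_pi (x : L) : quo := \pi_(Quotient.quot (ideal_pred I)) x.

Lemma quo_pi_zmod : zmod_morphism quo_pi.
Proof. by move=> x y; rewrite /quo_pi raddfB. Qed.
HB.instance Definition _ := GRing.isZmodMorphism.Build L quo quo_pi quo_pi_zmod.

Lemma quo_piP (q : quo) : exists x, q = quo_pi x.
Proof.
by exists (repr (q : Quotient.quot (ideal_pred I))); rewrite /quo_pi reprK.
Qed.

Lemma quo_pi_eq x y : quo_pi x = quo_pi y <-> x - y \in ideal_pred I.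
Proof. by rewrite Quotient.idealrBE; split => [/eqP|/eqP]. Qed.

Definition quo_repr (q : quo) : L := repr (q : Quotient.quot (ideal_pred I)).

Lemma quo_reprK : cancel quo_repr quo_pi.
Proof. by move=> q; rewrite /quo_pi reprK. Qed.

Lemma quo_repr_pi x : quo_repr (quo_pi x) - x \in ideal_pred I.
Proof. by apply/quo_pi_eq; rewrite quo_reprK. Qed.

Definition quo_scale (k : F) (q : quo) : quo := quo_pi (k *: quo_repr q).

Lemma quo_scale_pi k x : quo_scale k (quo_pi x) = quo_pi (k *: x).
Proof. by apply/quo_pi_eq; rewrite -scalerBr rpredZ ?quo_repr_pi. Qed.

Lemma quo_scaleA a b v : quo_scale a (quo_scale b v) = quo_scale (a * b) v.
Proof. by case: (quo_piP v) => x ->; rewrite !quo_scale_pi scalerA. Qed.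

Lemma quo_scale1 : left_id 1 quo_scale.
Proof. by move=> v; case: (quo_piP v) => x ->; rewrite quo_scale_pi scale1r. Qed.

Lemma quo_scaleDr : right_distributive quo_scale +%R.
Proof.
move=> a u v; case: (quo_piP u) (quo_piP v) => x -> [y ->].
by rewrite -raddfD !quo_scale_pi scalerDr raddfD.
Qed.

Lemma quo_scaleDl v : {morph quo_scale^~ v : a b / a + b}.
Proof.
by move=> a b; case: (quo_piP v) => x ->; rewrite !quo_scale_pi scalerDl raddfD.
Qed.

HB.instance Definition _ := GRing.Zmodule_isLmodule.Build F quo
  quo_scaleA quo_scale1 quo_scaleDr quo_scaleDl.

Lemma quo_pi_scalable : scalable quo_pi.
Proof. by move=> k x; rewrite -quo_scale_pi. Qed.
HB.instance Definition _ :=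
  GRing.isScalable.Build F L quo *:%R quo_pi quo_pi_scalable.

Definition quo_br (p q : quo) : quo := quo_pi (br (quo_repr p) (quo_repr q)).

Lemma quo_br_pi x y : quo_br (quo_pi x) (quo_pi y) = quo_pi (br x y).
Proof.
apply/quo_pi_eq.
rewrite -[_ - _](subrKA (br x (quo_repr (quo_pi y)))) -linearBl -linearBr.
by apply: rpredD; [apply: ideal_brl | apply: ideal_brr]; apply: quo_repr_pi.
Qed.

Lemma quo_br_bilinear : bilinear_for *:%R *:%R quo_br.
Proof.
split=> w k u v; have [[x ->] [y ->] [z ->]] :=
  And3 (quo_piP u) (quo_piP v) (quo_piP w).
  by rewrite -linearP !quo_br_pi linearPl linearP.
by rewrite -linearP !quo_br_pi linearPr linearP.
Qed.
HB.instance Definition _ :=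
  bilinear_isBilinear.Build F quo quo quo *:%R *:%R quo_br quo_br_bilinear.

Definition quo_homog (a : bool) : {pred quo} :=
  fun q => `[< exists2 x, x \in homog L a & q = quo_pi x >].

Lemma quo_homogP a q :
  reflect (exists2 x, x \in homog L a & q = quo_pi x) (q \in quo_homog a).
Proof. exact: asboolP. Qed.

Lemma quo_homog_submod a : submod_closed (quo_homog a).
Proof.
split; first by apply/quo_homogP; exists 0; rewrite ?rpred0 ?raddf0.
move=> k u v /quo_homogP[x xa ->] /quo_homogP[y ya ->]; apply/quo_homogP.
by exists (k *: x + y); rewrite ?linearP // rpredD ?rpredZ.
Qed.

Lemma quo_homog_span q : exists q0 q1,
  [/\ q0 \in quo_homog false, q1 \in quo_homog true & q = q0 + q1].
Proof.
have [x ->] := quo_piP q; have [x0 [x1 [h0 h1 ->]]] := homog_span x.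
exists (quo_pi x0), (quo_pi x1); rewrite raddfD.
by split=> //; apply/quo_homogP; [exists x0 | exists x1].
Qed.

Lemma quo_homog_disjoint q :
  q \in quo_homog false -> q \in quo_homog true -> q = 0.
Proof.
move=> /quo_homogP[x x0 ->] /quo_homogP[y y1 /quo_pi_eq xyI].
have [|xI _] := @ideal_graded _ _ I x (- y) x0 _ xyI; first by rewrite rpredN.
by rewrite -(raddf0 quo_pi); apply/quo_pi_eq; rewrite subr0.
Qed.

Lemma quo_br_homog a b p q : p \in quo_homog a -> q \in quo_homog b ->
  quo_br p q \in quo_homog (a (+) b).
Proof.
move=> /quo_homogP[x xa ->] /quo_homogP[y yb ->]; apply/quo_homogP.
by exists (br x y); rewrite ?quo_br_pi ?br_homog.
Qed.

Lemma quo_br_skew a b p q : p \in quo_homog a -> q \in quo_homog b ->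
  quo_br p q = - ((-1) ^+ (a && b) *: quo_br q p).
Proof.
move=> /quo_homogP[x xa ->] /quo_homogP[y yb ->].
by rewrite !quo_br_pi -linearZ -raddfN -br_skew.
Qed.

Lemma quo_br_jacobi a b c p q r :
  p \in quo_homog a -> q \in quo_homog b -> r \in quo_homog c ->
  quo_br p (quo_br q r) =
    quo_br (quo_br p q) r + (-1) ^+ (a && b) *: quo_br q (quo_br p r).
Proof.
move=> /quo_homogP[x xa ->] /quo_homogP[y yb ->] /quo_homogP[z zc ->].
by rewrite !quo_br_pi -linearZ -raddfD; congr quo_pi; apply: br_jacobi xa yb zc.
Qed.

Lemma quo_br_even_alt p : p \in quo_homog false -> quo_br p p = 0.
Proof. by move=> /quo_homogP[x x0 ->]; rewrite quo_br_pi br_even_alt ?raddf0. Qed.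

Lemma quo_br_odd_cube p : p \in quo_homog true -> quo_br p (quo_br p p) = 0.
Proof.
by move=> /quo_homogP[x x0 ->]; rewrite !quo_br_pi br_odd_cube ?raddf0.
Qed.

Definition quo_lsa : lieSuperalgebra F := LieSuperalgebra (br := quo_br)
  quo_homog_submod quo_homog_span quo_homog_disjoint quo_br_homog quo_br_skew
  quo_br_jacobi quo_br_even_alt quo_br_odd_cube.

End Quotient.

Section UpperCentral.
Variables (F : fieldType) (L : lieSuperalgebra F).

Definition centre : {pred L} := fun x => `[< forall y, br x y = 0 >].

Definition centre2 : {pred L} := fun x => `[< forall y, br x y \in centre >].

Lemma centreP x : reflect (forall y, br x y = 0) (x \in centre).
Proof. exact: asboolP. Qed.

Lemma centre2P x : reflect (forall y, br x y \in centre) (x \in centre2).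
Proof. exact: asboolP. Qed.

Lemma centre_submod : submod_closed centre.
Proof.
split; first by apply/centreP => y; rewrite linear0l.
move=> k u v /centreP uZ /centreP vZ; apply/centreP => y.
by rewrite linearPl uZ vZ scaler0 addr0.
Qed.
HB.instance Definition _ := GRing.isSubmodClosed.Build F L centre centre_submod.

Lemma centre2_submod : submod_closed centre2.
Proof.
split; first by apply/centre2P => y; rewrite linear0l rpred0.
move=> k u v /centre2P uZ /centre2P vZ; apply/centre2P => y.
by rewrite linearPl rpredD ?rpredZ.
Qed.
HB.instance Definition _ :=
  GRing.isSubmodClosed.Build F L centre2 centre2_submod.

Lemma homog_sum_eq0 a x y : x \in homog L a -> y \in homog L (~~ a) ->
  x + y = 0 -> x = 0 /\ y = 0.
Proof.
move=> xa ya /eqP; rewrite addr_eq0 => /eqP xE.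
have x_na : x \in homog L (~~ a) by rewrite xE rpredN.
have x0 : x = 0 by case: a xa x_na {ya} => xa x_na; apply: homog_disjoint.
by split=> //; apply: oppr_inj; rewrite -xE x0 oppr0.
Qed.

Lemma centre_graded x0 x1 : x0 \in homog L false -> x1 \in homog L true ->
  x0 + x1 \in centre -> x0 \in centre /\ x1 \in centre.
Proof.
move=> h0 h1 /centreP xZ.
have hZ b y : y \in homog L b -> br x0 y = 0 /\ br x1 y = 0.
  move=> yb; apply: (@homog_sum_eq0 b); [exact: (br_homog h0 yb) | |].
    by have := br_homog h1 yb; rewrite addTb.
  by rewrite -linearDl xZ.
split; apply/centreP => y; have [y0 [y1 [/hZ[e1 e2] /hZ[e3 e4] ->]]] :=
  homog_span y; by rewrite linearDr ?(e1, e2, e3, e4) addr0.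
Qed.

Lemma centre2_graded x0 x1 : x0 \in homog L false -> x1 \in homog L true ->
  x0 + x1 \in centre2 -> x0 \in centre2 /\ x1 \in centre2.
Proof.
move=> h0 h1 /centre2P xZ.
have hZ b y : y \in homog L b -> br x0 y \in centre /\ br x1 y \in centre.
  move=> yb; have := xZ y; rewrite linearDl.
  have := br_homog h0 yb; have := br_homog h1 yb.
  rewrite addTb addFb; case: b {yb} => /= p1 p0 pZ.
    by rewrite addrC in pZ; have [] := centre_graded p1 p0 pZ.
  exact: centre_graded pZ.
split; apply/centre2P => y; have [y0 [y1 [/hZ[e1 e2] /hZ[e3 e4] ->]]] :=
  homog_span y; by rewrite linearDr rpredD.
Qed.

Lemma centre_brr x y : y \in centre -> br x y = 0.
Proof.
have [y0 [y1 [h0 h1 ->]]] := homog_span y => /(centre_graded h0 h1).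
case=> /centreP y0Z /centreP y1Z.
have [x0 [x1 [g0 g1 ->]]] := homog_span x; rewrite linearDl !linearDr /=.
rewrite (br_skew g0 h0) (br_skew g0 h1) (br_skew g1 h0) (br_skew g1 h1).
by rewrite !y0Z !y1Z !scaler0 !oppr0 !addr0.
Qed.

Lemma centre2_brr x y : y \in centre2 -> br x y \in centre.
Proof.
have [y0 [y1 [h0 h1 ->]]] := homog_span y => /(centre2_graded h0 h1).
case=> /centre2P y0Z /centre2P y1Z.
have [x0 [x1 [g0 g1 ->]]] := homog_span x; rewrite linearDl !linearDr /=.
rewrite (br_skew g0 h0) (br_skew g0 h1) (br_skew g1 h0) (br_skew g1 h1).
by rewrite !rpredD // rpredN rpredZ.
Qed.

Lemma centre_sub2 x : x \in centre -> x \in centre2.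
Proof. by move=> /centreP xZ; apply/centre2P => y; rewrite xZ rpred0. Qed.

Lemma centre2_brl x y : x \in centre2 -> br x y \in centre2.
Proof. by move=> /centre2P xZ; apply: centre_sub2. Qed.

Definition centre2_ideal : gradedIdeal L := GradedIdeal centre2_submod
  centre2_brl (fun x y yZ => centre_sub2 (centre2_brr x yZ)) centre2_graded.

End UpperCentral.

Definition two_capable (F : fieldType) (L : lieSuperalgebra F) : Prop :=
  exists H : lieSuperalgebra F, lsa_iso L (quo_lsa (centre2_ideal H)).

(* An element ((u, c), v) of [heis F m n] is the vector
   \sum_(i < 2m) u_i x_i + c z + \sum_(j < n) v_j y_j. *)
Section Heisenberg.
Variables (F : fieldType) (m n : nat).

Definition heis : Type := ('rV[F]_(m + m) * F^o * 'rV[F]_n)%type.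
HB.instance Definition _ := GRing.Lmodule.on heis.

Definition heis_x (i : 'I_(m + m)) : heis := (delta_mx 0 i, 0, 0).
Definition heis_z : heis := (0, 1, 0).
Definition heis_y (j : 'I_n) : heis := (0, 0, delta_mx 0 j).

Definition heis_form (s t : heis) : F :=
  \sum_(i < m) (s.1.1 0 (lshift m i) * t.1.1 0 (rshift m i)
                - s.1.1 0 (rshift m i) * t.1.1 0 (lshift m i))
  + \sum_(j < n) s.2 0 j * t.2 0 j.

Definition heis_br (s t : heis) : heis := heis_form s t *: heis_z.

Definition heis_homog (a : bool) : {pred heis} :=
  fun s => if a then s.1 == 0 else s.2 == 0.

Lemma heis_formPl k s s' t :
  heis_form (k *: s + s') t = k * heis_form s t + heis_form s' t.
Proof.
rewrite /heis_form mulrDr !mulr_sumr addrACA -!big_split /=.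
by congr (_ + _); apply: eq_bigr => i _; rewrite !mxE; ring.
Qed.

Lemma heis_formPr k s t t' :
  heis_form s (k *: t + t') = k * heis_form s t + heis_form s t'.
Proof.
rewrite /heis_form mulrDr !mulr_sumr addrACA -!big_split /=.
by congr (_ + _); apply: eq_bigr => i _; rewrite !mxE; ring.
Qed.

Lemma heis_br_bilinear : bilinear_for *:%R *:%R heis_br.
Proof.
split=> w k u v; rewrite /heis_br ?heis_formPl ?heis_formPr.
  by rewrite scalerDl -scalerA.
by rewrite scalerDl -scalerA.
Qed.
HB.instance Definition _ :=
  bilinear_isBilinear.Build F heis heis heis *:%R *:%R heis_br heis_br_bilinear.

Lemma heis_homogE a s :
  (s \in heis_homog a) = if a then s.1 == 0 else s.2 == 0.
Proof. by []. Qed.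

Lemma heis_homog_submod a : submod_closed (heis_homog a).
Proof.
by split=> [|k u v]; rewrite !heis_homogE; case: a => //= /eqP uE /eqP vE;
  rewrite ?uE ?vE ?scaler0 addr0.
Qed.

Lemma heis_homog_span s : exists s0 s1,
  [/\ s0 \in heis_homog false, s1 \in heis_homog true & s = s0 + s1].
Proof.
exists (s.1, 0), (0, s.2); split; rewrite ?heis_homogE //=.
by case: s => u v; congr pair; rewrite /= ?addr0 ?add0r.
Qed.

Lemma heis_homog_disjoint s :
  s \in heis_homog false -> s \in heis_homog true -> s = 0.
Proof. by case: s => u v /eqP/= -> /eqP/= ->. Qed.

Lemma heis_form_mixed a b s t : s \in heis_homog a -> t \in heis_homog b ->
  a (+) b -> heis_form s t = 0.
Proof.
rewrite !heis_homogE /heis_form; case: a; case: b => //= /eqP sE /eqP tE _;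
  rewrite sE tE /= !big1 ?addr0 // => i _; rewrite !mxE ?mul0r ?mulr0 ?subr0 //.
Qed.

Lemma heis_br_homog a b s t : s \in heis_homog a -> t \in heis_homog b ->
  heis_br s t \in heis_homog (a (+) b).
Proof.
move=> sa tb; case ab: (a (+) b); last by rewrite heis_homogE /= scaler0.
by rewrite /heis_br (heis_form_mixed sa tb ab) scale0r heis_homogE.
Qed.

Lemma heis_form_skew a b s t : s \in heis_homog a -> t \in heis_homog b ->
  heis_form s t = - ((-1) ^+ (a && b) * heis_form t s).
Proof.
move=> sa tb; case ab: (a (+) b).
  by rewrite (heis_form_mixed sa tb ab) (heis_form_mixed tb sa) ?mulr0 ?oppr0 //
    addbC.
move: sa tb; rewrite !heis_homogE /heis_form; case: a b ab => [] [] //= _;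
  move=> /eqP-> /eqP->; rewrite ?expr1 ?expr0 ?mulN1r ?mul1r ?opprK.
  by congr (_ + _); apply: eq_bigr => i _; rewrite ?mxE; ring.
rewrite opprD -!sumrN.
by congr (_ + _); apply: eq_bigr => i _; rewrite ?mxE; ring.
Qed.

Lemma heis_br_skew a b s t : s \in heis_homog a -> t \in heis_homog b ->
  heis_br s t = - ((-1) ^+ (a && b) *: heis_br t s).
Proof.
by move=> sa tb; rewrite /heis_br (heis_form_skew sa tb) scaleNr scalerA.
Qed.

Lemma heis_form_zl s : heis_form heis_z s = 0.
Proof. by rewrite /heis_form !big1 ?addr0 // => i _; rewrite !mxE; ring. Qed.

Lemma heis_form_zr s : heis_form s heis_z = 0.
Proof. by rewrite /heis_form !big1 ?addr0 // => i _; rewrite !mxE; ring. Qed.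

Lemma heis_br_brl s t r : heis_br (heis_br s t) r = 0.
Proof. by rewrite {2}/heis_br linearZl_LR /= /heis_br heis_form_zl scale0r scaler0. Qed.

Lemma heis_br_brr s t r : heis_br s (heis_br t r) = 0.
Proof. by rewrite {2}/heis_br linearZr_LR /= /heis_br heis_form_zr scale0r scaler0. Qed.

Lemma heis_br_jacobi a b c s t r :
  s \in heis_homog a -> t \in heis_homog b -> r \in heis_homog c ->
  heis_br s (heis_br t r) =
    heis_br (heis_br s t) r + (-1) ^+ (a && b) *: heis_br t (heis_br s r).
Proof. by move=> _ _ _; rewrite heis_br_brl !heis_br_brr scaler0 addr0. Qed.

Lemma heis_br_even_alt s : s \in heis_homog false -> heis_br s s = 0.
Proof.
rewrite heis_homogE /heis_br /heis_form => /eqP ->.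
by rewrite !big1 ?addr0 ?scale0r // => i _; rewrite ?mxE; ring.
Qed.

Lemma heis_br_odd_cube s : s \in heis_homog true -> heis_br s (heis_br s s) = 0.
Proof. by rewrite heis_br_brr. Qed.

Definition heisenberg : lieSuperalgebra F := LieSuperalgebra (br := heis_br)
  heis_homog_submod heis_homog_span heis_homog_disjoint heis_br_homog
  heis_br_skew heis_br_jacobi heis_br_even_alt heis_br_odd_cube.

Lemma heis_br_xx (i j : 'I_m) :
  heis_br (heis_x (lshift m i)) (heis_x (rshift m j)) = (i == j)%:R *: heis_z.
Proof.
rewrite /heis_br; congr (_ *: _); rewrite /heis_form /= addrC big1 ?add0r.
  rewrite (bigD1 i) //= big1 => [|k ki]; rewrite !mxE !eqxx /=.
    by rewrite eq_lrshift mulr0 subr0 mul1r addr0 eq_rshift.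
  by rewrite eq_lshift (negPf ki) eq_rlshift !mul0r subr0.
by move=> k _; rewrite !mxE mul0r.
Qed.

Lemma heis_br_yy (i j : 'I_n) :
  heis_br (heis_y i) (heis_y j) = (i == j)%:R *: heis_z.
Proof.
rewrite /heis_br; congr (_ *: _); rewrite /heis_form /= big1 ?add0r.
  rewrite (bigD1 i) //= big1 => [|k ki]; rewrite !mxE ?eqxx /=.
    by rewrite mul1r addr0.
  by rewrite (negPf ki) mul0r.
by move=> k _; rewrite !mxE mul0r subrr.
Qed.

End Heisenberg.

(* Main.v *)
Require Import Defs.
From HB Require Import structures.
From mathcomp Require Import all_boot all_algebra.

Set Implicit Arguments.
Unset Strict Implicit.
Unset Printing Implicit Defensive.

Import GRing.Theory.
Local Open Scope ring_scope.

(** Necessity.  Suppose that H / Z_2(H) is H(m,n).  Since z is nonzero in the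
    quotient, a lift of z is outside Z_2(H), so some bracket of it is outside
    Z(H).  The Jacobi identity restricts these brackets: if z = [x,y] and t
    commutes with both x and y in the quotient, then in H the brackets [x,t] and
    [y,t] of lifts lie in Z_2(H), hence
    [[x,y],t] = [x,[y,t]] - (-1)^{|x||y|} [y,[x,t]] lies in Z(H)
    ([lifts_commute_jacobi]).  So only elements that are not sums of such t can
    have a lift whose bracket with that of z is not central.  The y_j never do,
    as z = [y_j,y_j] and [y,[y,y]] = 0 for every odd y of H
    ([lifts_commute_cube]).  If n > 0, every even t commutes with y_1, and
    z = [y_1,y_1].  If m > 1, every even t is a sum of an element commuting with
    the first pair x_1, x_{m+1} and of one commuting with the second.  Hence
    either condition forces the lifts of z into Z_2(H), a contradiction, and only
    m = 1, n = 0 survives.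

    Sufficiency.  H(1,0) is H / Z_2(H) for the filiform Lie algebra H with basis
    X, e_1, ..., e_4 and brackets [X,e_i] = e_{i+1} for i < 4: its upper central series
    starts with <e_4> and <e_3,e_4>, and the quotient by <e_3,e_4> is spanned by
    X, e_1 and e_2 = [X,e_1].  It is the extension of an abelian algebra by one
    derivation, a construction which gives a Lie superalgebra over any field. *)

(** * Brackets of lifts along L = H / Z_2(H) *)

Section Obstruction.
Variables (F : fieldType) (L H : lieSuperalgebra F).
Variable f : {linear L -> quo_lsa (centre2_ideal H)}.
Hypothesis f_bij : bijective f.
Hypothesis f_homog : forall a x, x \in homog L a ->
  f x \in homog (quo_lsa (centre2_ideal H)) a.
Hypothesis f_br : forall x y, f (br x y) = br (f x) (f y).

Definition lifts (h : H) (x : L) : Prop :=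
  quo_pi (centre2_ideal H) h = f x.

(** Commutation is meant modulo the centre of H, which is what membership in
    Z_2(H) asks for. *)
Definition lifts_commute (x y : L) : Prop :=
  forall h k : H, lifts h x -> lifts k y -> br h k \in @centre F H.

Lemma lifts_sub h h' x : lifts h x -> lifts h' x -> h - h' \in @centre2 F H.
Proof. by rewrite /lifts => <- /esym; apply: (quo_pi_eq _ _ _).1. Qed.

Lemma lifts_exists x : exists h, lifts h x.
Proof. by have [h hE] := quo_piP (f x); exists h. Qed.

Lemma lifts_homog a x : x \in homog L a ->
  exists2 h, h \in homog H a & lifts h x.
Proof. by move=> /f_homog/quo_homogP[h ha hE]; exists h. Qed.

Lemma lifts_br h k x y : lifts h x -> lifts k y -> lifts (br h k) (br x y).
Proof. by rewrite /lifts f_br => <- <-; rewrite -quo_br_pi. Qed.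

Lemma lifts0 h : lifts h 0 -> h \in @centre2 F H.
Proof.
have : lifts 0 0 by rewrite /lifts !raddf0.
by move=> l0 /lifts_sub/(_ l0); rewrite subr0.
Qed.

(** Two lifts differ by an element of Z_2(H), whose brackets are central; so the
    choice of lifts does not matter, and homogeneous ones may be used. *)
Lemma lifts_commute_witness h k x y : lifts h x -> lifts k y ->
  br h k \in @centre F H -> lifts_commute x y.
Proof.
move=> hx ky hkZ h' k' h'x k'y.
have -> : br h' k' = br h' (k' - k) + br (h' - h) k + br h k.
  by rewrite linearBr linearBl /= subrKA subrK.
have /centre2P h'hZ := lifts_sub h'x hx.
by rewrite !rpredD // centre2_brr // (lifts_sub k'y).
Qed.

Lemma lifts_commute_linear x k y y' :
  lifts_commute x y -> lifts_commute x y' -> lifts_commute x (k *: y + y').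
Proof.
have [[h hx] [g gy] [g' gy']] :=
  And3 (lifts_exists x) (lifts_exists y) (lifts_exists y').
move=> /(_ h g hx gy) hgZ /(_ h g' hx gy') hg'Z.
apply: (@lifts_commute_witness h (k *: g + g')) => //.
  by rewrite /lifts !linearP /= gy gy'.
by rewrite linearPr rpredD ?rpredZ.
Qed.

Lemma lifts_commute0 x : lifts_commute x 0.
Proof.
have [h hx] := lifts_exists x.
have l0 : lifts 0 0 by rewrite /lifts !raddf0.
by apply: (lifts_commute_witness hx l0); rewrite linear0r rpred0.
Qed.

(** Lifts X, Y, T satisfy [X,T], [Y,T] \in Z_2(H), and the Jacobi identity writes
    [[X,Y],T] through the central elements [X,[Y,T]] and [Y,[X,T]]. *)
Lemma lifts_commute_jacobi a b c x y t :
    x \in homog L a -> y \in homog L b -> t \in homog L c ->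
  br x t = 0 -> br y t = 0 -> lifts_commute (br x y) t.
Proof.
move=> xa yb tc xt0 yt0.
have [[X Xa Xx] [Y Yb Yy] [T Tc Tt]] :=
  And3 (lifts_homog xa) (lifts_homog yb) (lifts_homog tc).
apply: (lifts_commute_witness (lifts_br Xx Yy) Tt).
have XT : br X T \in @centre2 F H by apply: lifts0; rewrite -xt0; apply: lifts_br.
have YT : br Y T \in @centre2 F H by apply: lifts0; rewrite -yt0; apply: lifts_br.
have := br_jacobi Xa Yb Tc; move/eqP; rewrite -subr_eq => /eqP <-.
by rewrite rpredB ?rpredZ ?centre2_brr.
Qed.

(** This covers the case t = x = y, where the Jacobi argument does not apply
    since [y,y] need not vanish. *)
Lemma lifts_commute_cube y : y \in homog L true -> lifts_commute (br y y) y.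
Proof.
move=> y1; have [Y Y1 Yy] := lifts_homog y1.
apply: (lifts_commute_witness (lifts_br Yy Yy) Yy).
by rewrite (br_skew (br_homog Y1 Y1) Y1) br_odd_cube // scaler0 oppr0 rpred0.
Qed.

(** The source of the contradictions: H / Z_2(H) has no nonzero element whose
    lifts are central modulo Z(H). *)
Lemma lifts_commute_eq0 x : (forall y, lifts_commute x y) -> x = 0.
Proof.
move=> xZ; have [h hx] := lifts_exists x.
have h2 : h \in @centre2 F H.
  apply/centre2P => k; case: f_bij => g _ gK.
  by apply: (xZ (g (quo_pi _ k))) => //; rewrite /lifts gK.
apply: (bij_inj f_bij); rewrite -hx !raddf0.
by rewrite -[RHS](raddf0 (quo_pi (centre2_ideal H))); apply/quo_pi_eq; rewrite subr0.
Qed.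

End Obstruction.

(** * Only H(1,0) can be 2-capable *)

Section HeisenbergForm.
Variables (F : fieldType) (m n : nat).
Implicit Types (s t : heisenberg F m n).

Lemma heis_form_xl (i : 'I_m) s :
  heis_form (heis_x F n (lshift m i)) s = s.1.1 0 (rshift m i).
Proof.
rewrite /heis_form (bigD1 i) //= !big1 ?addr0; first last.
- by move=> j /negPf ji; rewrite !mxE eqxx eq_lshift eq_rlshift ji /= !mul0r subr0.
- by move=> j _; rewrite mxE mul0r.
by rewrite !mxE !eqxx eq_rlshift mul1r mul0r subr0.
Qed.

Lemma heis_form_xr (i : 'I_m) s :
  heis_form (heis_x F n (rshift m i)) s = - s.1.1 0 (lshift m i).
Proof.
rewrite /heis_form (bigD1 i) //= !big1 ?addr0; first last.
- by move=> j /negPf ji; rewrite !mxE eqxx eq_rshift eq_lrshift ji /= !mul0r subr0.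
- by move=> j _; rewrite mxE mul0r.
by rewrite !mxE !eqxx eq_lrshift mul1r mul0r sub0r.
Qed.

Lemma heis_brE s t : br s t = heis_form s t *: (heis_z F m n : heisenberg F m n).
Proof. by []. Qed.

Lemma heis_z_neq0 : heis_z F m n <> 0.
Proof. by move=> [] /eqP; rewrite oner_eq0. Qed.

End HeisenbergForm.

Section HeisenbergNotCapable.
Variables (F : fieldType) (m n : nat) (H : lieSuperalgebra F).
Let L := heisenberg F m n.
Variable f : {linear L -> quo_lsa (centre2_ideal H)}.
Hypothesis f_homog : forall a x, x \in homog L a ->
  f x \in homog (quo_lsa (centre2_ideal H)) a.
Hypothesis f_br : forall x y, f (br x y) = br (f x) (f y).
Let z : L := heis_z F m n.

Lemma heis_commute_pair (i : 'I_m) (t : L) : t \in homog L false ->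
  t.1.1 0 (lshift m i) = 0 -> t.1.1 0 (rshift m i) = 0 -> lifts_commute f z t.
Proof.
move=> t0 tl tr.
have <- : br (heis_x F n (lshift m i) : L) (heis_x F n (rshift m i)) = z.
  by rewrite [LHS]heis_br_xx eqxx scale1r.
apply: (lifts_commute_jacobi f_homog f_br (a := false) (b := false) _ _ t0).
- by rewrite [_ \in _]eqxx.
- by rewrite [_ \in _]eqxx.
- by rewrite heis_brE heis_form_xl tr scale0r.
- by rewrite heis_brE heis_form_xr tl oppr0 scale0r.
Qed.

Lemma heis_commute_even_odd (j : 'I_n) (t : L) :
  t \in homog L false -> lifts_commute f z t.
Proof.
move=> t0; have <- : br (heis_y F m j : L) (heis_y F m j) = z.
  by rewrite [LHS]heis_br_yy eqxx scale1r.
have y1 : heis_y F m j \in homog L true by rewrite [_ \in _]eqxx.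
have yt : br (heis_y F m j : L) t = 0.
  by rewrite heis_brE (heis_form_mixed y1 t0) ?scale0r.
exact: (lifts_commute_jacobi f_homog f_br y1 y1 t0).
Qed.

(** Splitting off the coordinates of t on the i-th pair leaves one part that
    commutes with the i-th pair and one that commutes with the j-th. *)
Lemma heis_commute_even (i j : 'I_m) (t : L) : i != j ->
  t \in homog L false -> lifts_commute f z t.
Proof.
move=> ij t0; have /eqP t20 : t.2 == 0 := t0.
pose u : 'rV[F]_(m + m) := t.1.1 0 (lshift m i) *: delta_mx 0 (lshift m i)
  + t.1.1 0 (rshift m i) *: delta_mx 0 (rshift m i).
have -> : t = 1 *: ((t.1.1 - u, t.1.2, 0) : L) + (u, 0, 0).
  rewrite scale1r {}/u; case: (t) t20 => [[a b] c] /= ->.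
  apply: injective_projections; last by rewrite /= addr0.
  by apply: injective_projections; rewrite /= ?subrK ?addr0.
apply: lifts_commute_linear.
  apply: (@heis_commute_pair i); rewrite ?[_ \in _]eqxx //= !mxE !eqxx /=;
  by rewrite ?eq_lrshift ?eq_rlshift ?mulr1 ?mulr0 ?addr0 ?add0r subrr.
apply: (@heis_commute_pair j); rewrite ?[_ \in _]eqxx //= !mxE /=;
by rewrite ?eq_lrshift ?eq_rlshift ?eq_lshift ?eq_rshift eq_sym (negPf ij) ?mulr0 addr0.
Qed.

Lemma heis_commute_odd (t : L) : t \in homog L true -> lifts_commute f z t.
Proof.
move=> /eqP t0; have -> : t = \sum_j t.2 0 j *: (heis_y F m j : L).
  rewrite (surjective_pairing t) t0 /= {1}(row_sum_delta t.2).
  elim/big_rec2: _ => // j u v _ <-.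
  apply: injective_projections => //=.
  by rewrite scaler0 addr0.
elim/big_ind: _ => [|u v uc vc|j _].
- exact: lifts_commute0.
- by rewrite -[u]scale1r; apply: lifts_commute_linear.
rewrite -[_ *: _]addr0; apply: lifts_commute_linear; last exact: lifts_commute0.
have -> : z = br (heis_y F m j : L) (heis_y F m j).
  by rewrite [RHS]heis_br_yy eqxx scale1r.
by apply: lifts_commute_cube; rewrite // [_ \in _]eqxx.
Qed.

End HeisenbergNotCapable.

Lemma two_capable_heisenberg_dim (F : fieldType) (m n : nat) :
  (1 <= m + n)%N -> two_capable (heisenberg F m n) -> m = 1%N /\ n = 0%N.
Proof.
move=> mn_gt0 [H [f [f_bij f_homog f_br]]].
have even_not : ~ forall t : heisenberg F m n, t \in homog _ false ->
    lifts_commute f (heis_z F m n) t.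
  move=> evenZ; apply: (@heis_z_neq0 F m n); apply: (lifts_commute_eq0 f_bij) => t.
  have [t0 [t1 [t00 t11 ->]]] := homog_span t.
  rewrite -[t0]scale1r; apply: lifts_commute_linear; first exact: evenZ.
  exact: heis_commute_odd.
case: n => [|n] in mn_gt0 f f_bij f_homog f_br even_not *; last first.
  by case: even_not => t; apply: (heis_commute_even_odd f_homog f_br ord0).
case: m => [|[|m]] // in mn_gt0 f f_bij f_homog f_br even_not *.
case: even_not => t.
exact: (@heis_commute_even _ _ _ _ f f_homog f_br ord0 (lift ord0 ord0)).
Qed.

(** * Extending an abelian Lie algebra by a derivation *)

Section DerivationExtension.
Variables (F : fieldType) (V : lmodType F) (D : {linear V -> V}).

(** A pair (a, v) stands for a D + v, with [D, v] = D v and V abelian. *)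
Definition der_ext : Type := (F^o * V)%type.
HB.instance Definition _ := GRing.Lmodule.on der_ext.
Implicit Types s t r : der_ext.

Definition der_br s t : der_ext := (0, s.1 *: D t.2 - t.1 *: D s.2).

Lemma der_br_bilinear : bilinear_for *:%R *:%R der_br.
Proof.
split=> w k u v; apply: injective_projections; rewrite /= ?scaler0 ?addr0 //;
  rewrite linearP /= scalerDl scalerDr scalerBr !scalerA (mulrC w.1) opprD.
  by rewrite addrACA.
by rewrite addrACA.
Qed.
HB.instance Definition _ := bilinear_isBilinear.Build F der_ext der_ext der_ext
  *:%R *:%R der_br der_br_bilinear.

Definition der_homog (a : bool) : {pred der_ext} := fun s => a ==> (s == 0).

Lemma der_homog_submod a : submod_closed (der_homog a).
Proof.
case: a; split=> //; first exact: eqxx.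
by move=> k u v /eqP-> /eqP->; rewrite scaler0 addr0 [_ \in _]eqxx.
Qed.

Lemma der_homog_span s : exists s0 s1,
  [/\ s0 \in der_homog false, s1 \in der_homog true & s = s0 + s1].
Proof. by exists s, 0; rewrite addr0 [0 \in _]eqxx. Qed.

Lemma der_homog_disjoint s :
  s \in der_homog false -> s \in der_homog true -> s = 0.
Proof. by move=> _ /eqP. Qed.

Lemma der_br_homog a b s t : s \in der_homog a -> t \in der_homog b ->
  der_br s t \in der_homog (a (+) b).
Proof.
by case: a; case: b => //=; [move=> /eqP-> _ | move=> _ /eqP->];
  rewrite ?linear0l ?linear0r [_ \in _]eqxx.
Qed.

Lemma der_brC s t : der_br s t = - der_br t s.
Proof. by apply: injective_projections; rewrite /= ?oppr0 ?opprB. Qed.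

Lemma der_br_skew a b s t : s \in der_homog a -> t \in der_homog b ->
  der_br s t = - ((-1) ^+ (a && b) *: der_br t s).
Proof.
case: a; case: b => /=; [move=> /eqP-> _| | |] => *; rewrite ?scale1r -?der_brC //.
by rewrite linear0l linear0r scaler0 oppr0.
Qed.

Lemma der_br_jacobi a b c s t r :
  s \in der_homog a -> t \in der_homog b -> r \in der_homog c ->
  der_br s (der_br t r) =
    der_br (der_br s t) r + (-1) ^+ (a && b) *: der_br t (der_br s r).
Proof.
case: a; case: b => /=; [move=> /eqP-> _ _| | |] => *.
  by rewrite !(linear0l, linear0r) scaler0 addr0.
all: rewrite scale1r; apply: injective_projections; rewrite /= ?addr0 //.
(* Both sides are s_1 t_1 D^2 r_2 - s_1 r_1 D^2 t_2 once the two copies of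
   t_1 r_1 D^2 s_2 cancel. *)
all: rewrite !scale0r !subr0 sub0r !linearB !linearZ /= !scalerA.
all: rewrite (mulrC t.1 s.1) (mulrC r.1 s.1) (mulrC r.1 t.1) opprK.
all: by rewrite [RHS]addrC addrACA !scalerN addNr addr0.
Qed.

Lemma der_br_even_alt s : s \in der_homog false -> der_br s s = 0.
Proof. by move=> _; rewrite /der_br subrr. Qed.

Lemma der_br_odd_cube s : s \in der_homog true -> der_br s (der_br s s) = 0.
Proof. by move=> /eqP ->; rewrite linear0l. Qed.

Definition der_lsa : lieSuperalgebra F := LieSuperalgebra (br := der_br)
  der_homog_submod der_homog_span der_homog_disjoint der_br_homog
  der_br_skew der_br_jacobi der_br_even_alt der_br_odd_cube.

End DerivationExtension.

(** * The filiform algebra covering H(1,0) *)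

Section Filiform.
Variable F : fieldType.
Let V : lmodType F := (F^o * F^o * F^o * F^o)%type.

Definition shift4 (v : V) : V := (0, v.1.1.1, v.1.1.2, v.1.2).

Lemma shift4_linear : linear shift4.
Proof.
by move=> k u v; do 3?apply: injective_projections; rewrite /= ?scaler0 ?addr0.
Qed.
HB.instance Definition _ := GRing.isLinear.Build F V V *:%R shift4 shift4_linear.

Definition filiform : lieSuperalgebra F := der_lsa shift4.
Implicit Types s t : filiform.

Lemma filiform_brE s t :
  br s t = ((0, s.1 *: shift4 t.2 - t.1 *: shift4 s.2) : filiform).
Proof. by []. Qed.

Lemma filiform_centre s : s \in @centre F filiform <->
  [/\ s.1 = 0, s.2.1.1.1 = 0, s.2.1.1.2 = 0 & s.2.1.2 = 0].
Proof.
split=> [/centreP sZ | [a p q r]]; last first.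
  apply/centreP => t; rewrite filiform_brE a /shift4 p q r.
  by rewrite scale0r sub0r (scaler0 V t.1 : _ *: (0, 0, 0, 0) = _) oppr0.
(* Brackets with e_1 and X, which generate the algebra. *)
have sY := sZ (0, (1, 0, 0, 0)); have sX := sZ (1, 0).
have /= a := congr1 (fun u : filiform => u.2.1.1.2) sY.
have /= p := congr1 (fun u : filiform => u.2.1.1.2) sX.
have /= q := congr1 (fun u : filiform => u.2.1.2) sX.
have /= r := congr1 (fun u : filiform => u.2.2) sX.
rewrite scale0r subr0 [_ *: _]mulr1 in a.
move: p q r; rewrite !scaler0 !sub0r !scale1r => p q r.
by split; apply: oppr_inj; rewrite ?a ?p ?q ?r oppr0.
Qed.

Lemma filiform_centre2 s : s \in @centre2 F filiform <->
  [/\ s.1 = 0, s.2.1.1.1 = 0 & s.2.1.1.2 = 0].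
Proof.
split=> [/centre2P sZ | [a p q]]; last first.
  apply/centre2P => t; apply/filiform_centre; rewrite filiform_brE a /=.
  by rewrite p q !scale0r !scaler0 !subr0.
have /filiform_centre[_ _ _ /= p] := sZ (1, 0).
have /filiform_centre[_ _ q _] := sZ (1, 0).
have /filiform_centre[_ _ a _] := sZ (0, (1, 0, 0, 0)).
move: p q a; rewrite /= !scaler0 !sub0r !scale1r scale0r subr0 => p q.
rewrite [_ *: _]mulr1 => a.
by split=> //; apply: oppr_inj; rewrite ?p ?q oppr0.
Qed.

Let L := heisenberg F 1 0.

Definition heis_lift (s : L) : filiform :=
  (s.1.1 0 (lshift 1 ord0), (s.1.1 0 (rshift 1 ord0), s.1.2, 0, 0)).

Lemma heis_lift_linear : linear heis_lift.
Proof.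
move=> k u v; do 4?apply: injective_projections;
  by rewrite /= ?mxE ?scaler0 ?addr0.
Qed.
HB.instance Definition _ :=
  GRing.isLinear.Build F L filiform *:%R heis_lift heis_lift_linear.

(** This map drops the coordinates on e_3 and e_4, which span Z_2 of the
    filiform algebra, so it descends to the quotient and inverts [heis_lift]
    there. *)
Definition heis_of_filiform (s : filiform) : L :=
  (row_mx (const_mx s.1) (const_mx s.2.1.1.1), s.2.1.1.2, 0).

Lemma heis_liftK : cancel heis_lift heis_of_filiform.
Proof.
move=> [[u c] v]; congr (_, _, _); last by apply/matrixP => i [].
apply/rowP => i; rewrite -[i]splitK; case: (split i) => j; rewrite /= (ord1 j).
  by rewrite row_mxEl mxE.
by rewrite row_mxEr mxE.
Qed.

Lemma heis_of_filiformK s : heis_lift (heis_of_filiform s) - s \in @centre2 F filiform.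
Proof.
apply/filiform_centre2.
by rewrite /heis_lift /= row_mxEl row_mxEr !mxE !subrr.
Qed.

Lemma heis_of_filiform_eq s t :
  s - t \in @centre2 F filiform -> heis_of_filiform s = heis_of_filiform t.
Proof.
move=> /filiform_centre2[/= /subr0_eq a /subr0_eq p /subr0_eq q].
by rewrite /heis_of_filiform a p q.
Qed.

Lemma two_capable_heisenberg10 : two_capable L.
Proof.
exists filiform, (quo_pi (centre2_ideal filiform) \o heis_lift); split.
- exists (heis_of_filiform \o @quo_repr _ _ _) => [s | q] /=.
    have := quo_repr_pi (centre2_ideal filiform) (heis_lift s).
    by move/heis_of_filiform_eq ->; rewrite heis_liftK.
  rewrite -[RHS]quo_reprK; apply/quo_pi_eq; exact: heis_of_filiformK.
- move=> a s sa; apply/quo_homogP; exists (heis_lift s) => //.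
  case: a sa => // /eqP; case: s => [u v] /= ->.
  by apply/eqP; rewrite /heis_lift /= !mxE.
- move=> s t /=; rewrite quo_br_pi; apply/quo_pi_eq/filiform_centre2.
  rewrite heis_brE filiform_brE /heis_form big_ord1 big_ord0 addr0.
  split; rewrite /heis_lift /= ?mxE ?scaler0 ?mulr0 ?subrr //.
  by rewrite [X in X - _]mulr1 [X in X - _ = _]addrC [X in _ - X]addrC
    [s.1.1 0 (rshift 1 ord0) * _]mulrC subrr.
Qed.

End Filiform.

Theorem theorem6p7 (F : closedFieldType) (m n : nat) (mn_gt0 : (1 <= m + n)%N) :
  two_capable (heisenberg F m n) <-> (m = 1%N /\ n = 0%N).
Proof.
split; first exact: two_capable_heisenberg_dim.
by case=> -> ->; apply: two_capable_heisenberg10.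
Qed.
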